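(* Let $\alpha\in(0,1)$ and let $(\mu_1^*,\mu_2^*,P^*,Y^* )$ be a solution of the semidefinite program $$\min_{P,Y,\mu_1,\mu_2}\ \mu_1+\mu_2\quad\text{s.t.}\quad \mu_1,\mu_2>0,\ P=P^\top>\mathbf{0},\ \begin{bmatrix}-P&*&*&*\\ A_e^\top(P-C_e^\top Y^\top)&(\alpha-1)P&*&*\\ B_{e1}^\top P&\mathbf{0}&-\alpha\mu_1I&*\\ Y^\top&\mathbf{0}&\mathbf{0}&-\alpha\mu_1I\end{bmatrix}\le0,\ \begin{bmatrix}P&I\\ I&\mu_2I\end{bmatrix}\ge0,$$ with $P\in\mathbb{R}^{6\times6}$, $Y\in\mathbb{R}^{6\times5}$; set $L=(P^* )^{-1}Y^*$ and $\gamma=\sqrt{\mu_1^*\mu_2^*}$. Let $\bar\omega_2,\bar\omega_3>0$ and consider the residual dynamics (with attack signal $\delta\equiv0$) $$e(k+1)=(I-LC_e)A_e\,e(k)-B_{e1}\omega_u(k)-L\omega_e(k+1),\qquad r(k+1)=C_eA_ee(k)+\omega_e(k+1),\qquad k\ge0 .$$ Suppose $\lambda_1,\lambda_2>0$ and a symmetric matrix $\Pi\in\mathbb{R}^{5\times5}$ solve the optimization problem $$\min_{\Pi,\lambda_1,\lambda_2}\ -\log\det\Pi\quad\text{s.t.}\quad \Pi>0,\ \lambda_1>0,\ \lambda_2>0,\quad \begin{bmatrix}f_1&*&*\\ \Pi C_eA_e&f_2&*\\ 0&0&f_3\end{bmatrix}\ge0,$$ where $f_1=\lambda_1I-A_e^\top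 C_e^\top\Pi C_eA_e$, $f_2=\lambda_2I-\Pi$, $f_3=1-\lambda_1\gamma^2(\bar\omega_2+\bar\omega_3)-\lambda_2\bar\omega_3$. Then, in steady state, the monitor ellipsoid defined by $\Pi$ contains all trajectories of the residual: for every initial error $e(0)\in\mathbb{R}^6$ and all disturbance sequences with $\omega_u(k)^\top\omega_u(k)\le\bar\omega_2$ and $\omega_e(k)^\top\omega_e(k)\le\bar\omega_3$ for all $k$, $$\limsup_{k\to\infty}\ r(k)^\top\Pi\,r(k)\le1 .$$
   Context: Let $h,\tau,T_s>0$ and $k_p,k_d\in\mathbb{R}$. Define $$A_{ce}=\begin{bmatrix}0&0&-h&0&1&0\\0&0&1&0&0&0\\0&0&-\frac1\tau&\frac1\tau&0&0\\ \frac{k_p}{h}&0&-k_d&-\frac1h&\frac{k_d}{h}&0\\0&0&-1&0&0&1\\0&0&0&0&0&-\frac1\tau\end{bmatrix},\quad B_{ce1}=[0\ 0\ 0\ 0\ 0\ \tfrac1\tau]^\top,$$ $A_e=e^{A_{ce}T_s}$, $B_{e1}=\int_0^{T_s}e^{A_{ce}(T_s-s)}B_{ce1}\,ds$, and $C_e=[I_5\ \ \mathbf{0}]\in\mathbb{R}^{5\times6}$ (the first five coordinates). Here $e(k)\in\mathbb{R}^6$, $\omega_u(k)\in\mathbb{R}$, $\omega_e(k)\in\mathbb{R}^5$, $r(k)\in\mathbb{R}^5$; $*$ denotes blocks determined by symmetry, and $>0$, $\ge0$, $\le0$ for symmetric matrices refer to definiteness/semidefiniteness. ''In steady state'' means after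 transients due to the initial condition have died out. *)

(* Defs.v *)
From HB Require Import structures.
From mathcomp Require Export all_boot all_order all_algebra.
From mathcomp Require Export all_classical all_reals all_analysis.
Set Implicit Arguments.
Unset Strict Implicit.
Unset Printing Implicit Defensive.
Export Order.TTheory GRing.Theory Num.Theory.
Export numFieldNormedType.Exports.
Local Open Scope classical_set_scope.
Local Open Scope ring_scope.

Section Definiteness.
Variables (R : realType) (n : nat).

Definition quad_form (M : 'M[R]_n) (x : 'cV[R]_n) : R :=
  (x^T *m M *m x) ord0 ord0.

Definition posdefmx (M : 'M[R]_n) : Prop :=
  M^T = M /\ forall x : 'cV[R]_n, x != 0 -> 0 < quad_form M x.

Definition possemidefmx (M : 'M[R]_n) : Prop :=
  M^T = M /\ forall x : 'cV[R]_n, 0 <= quad_form M x.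

Definition negsemidefmx (M : 'M[R]_n) : Prop :=
  M^T = M /\ forall x : 'cV[R]_n, quad_form M x <= 0.

End Definiteness.

(* The power series is summed in the normed space of matrices (max norm). *)
Definition expmx (R : realType) (n : nat) (A : 'M[R]_n.+1) : 'M[R]_n.+1 :=
  limn (series (fun k : nat => k`!%:R^-1 *: A ^+ k)).

Section Model.
Variables (R : realType) (h tau kp kd Ts : R).

Definition Ace : 'M[R]_6 :=
  \matrix_(i < 6, j < 6) nth 0 (nth [::]
    [:: [:: 0;      0; - h;      0;        1;      0];
        [:: 0;      0; 1;        0;        0;      0];
        [:: 0;      0; - tau^-1; tau^-1;   0;      0];
        [:: kp / h; 0; - kd;     - h^-1;   kd / h; 0];
        [:: 0;      0; - 1;      0;        0;      1];
        [:: 0;      0; 0;        0;        0;      - tau^-1]] i) j.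

Definition Bce1 : 'cV[R]_6 :=
  \col_(i < 6) nth 0 [:: 0; 0; 0; 0; 0; tau^-1] i.

Definition Ae : 'M[R]_6 := expmx (Ts *: Ace).

Definition Be1 : 'cV[R]_6 :=
  \col_(i < 6) \int[lebesgue_measure]_(s in `[0, Ts])
    (expmx ((Ts - s) *: Ace) *m Bce1) i ord0.

Definition Ce : 'M[R]_(5, 6) := row_mx 1%:M (0 : 'M[R]_(5, 1)).

End Model.

Section ObserverSDP.
Variables (R : realType) (A : 'M[R]_6) (B : 'cV[R]_6) (C : 'M[R]_(5, 6)).
Variable alpha : R.

(* The 2 x 2 outer blocks have sizes 6 + 6 and 1 + 5. *)
Definition observer_lmi (P : 'M[R]_6) (Y : 'M[R]_(6, 5)) (mu1 : R)
    : 'M[R]_((6 + 6) + (1 + 5)) :=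
  let M21 : 'M[R]_6 := A^T *m (P - C^T *m Y^T) in
  let M31 : 'M[R]_(1, 6) := B^T *m P in
  let M41 : 'M[R]_(5, 6) := Y^T in
  let Mul := block_mx (- P) M21^T M21 ((alpha - 1) *: P) in
  let Mdl := block_mx M31 0 M41 0 in
  let Mdr := block_mx (- (alpha * mu1))%:M 0 0 (- (alpha * mu1))%:M in
  block_mx Mul Mdl^T Mdl Mdr.

Definition observer_feasible (mu1 mu2 : R) (P : 'M[R]_6) (Y : 'M[R]_(6, 5))
    : Prop :=
  [/\ 0 < mu1, 0 < mu2, posdefmx P,
      negsemidefmx (observer_lmi P Y mu1) &
      possemidefmx (block_mx P 1%:M 1%:M mu2%:M)].

Definition observer_optimal (mu1 mu2 : R) (P : 'M[R]_6) (Y : 'M[R]_(6, 5))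
    : Prop :=
  observer_feasible mu1 mu2 P Y /\
  forall (nu1 nu2 : R) (Q : 'M[R]_6) (Z : 'M[R]_(6, 5)),
    observer_feasible nu1 nu2 Q Z -> mu1 + mu2 <= nu1 + nu2.

End ObserverSDP.

Section MonitorProblem.
Variables (R : realType) (A : 'M[R]_6) (C : 'M[R]_(5, 6)).
Variables (gamma ombar2 ombar3 : R).

Definition monitor_lmi (Pi : 'M[R]_5) (lambda1 lambda2 : R)
    : 'M[R]_((6 + 5) + 1) :=
  let f1 : 'M[R]_6 := lambda1%:M - A^T *m C^T *m Pi *m C *m A in
  let f2 : 'M[R]_5 := lambda2%:M - Pi in
  let f3 : R :=
    1 - lambda1 * gamma ^+ 2 * (ombar2 + ombar3) - lambda2 * ombar3 in
  let M21 : 'M[R]_(5, 6) := Pi *m C *m A in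
  block_mx (block_mx f1 M21^T M21 f2) 0 0 f3%:M.

Definition monitor_feasible (Pi : 'M[R]_5) (lambda1 lambda2 : R) : Prop :=
  [/\ posdefmx Pi, 0 < lambda1, 0 < lambda2 &
      possemidefmx (monitor_lmi Pi lambda1 lambda2)].

Definition monitor_optimal (Pi : 'M[R]_5) (lambda1 lambda2 : R) : Prop :=
  monitor_feasible Pi lambda1 lambda2 /\
  forall (Xi : 'M[R]_5) (nu1 nu2 : R),
    monitor_feasible Xi nu1 nu2 -> - ln (\det Pi) <= - ln (\det Xi).

End MonitorProblem.

(* Main.v *)
(** Set V(e) = e^T P e. Testing the observer LMI on the vector
    (e(k+1), e(k), - omega_u(k), - omega_e(k+1)) and using P L = Y gives
    V(e(k+1)) <= (1 - alpha) V(e(k)) + alpha mu1 (ombar2 + ombar3), while the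
    second LMI gives |e|^2 <= mu2 V(e). Hence |e(k)|^2 is at most
    gamma^2 (ombar2 + ombar3) plus a multiple of (1 - alpha)^k. Testing the
    monitor LMI on (e(k), - omega_e(k+1), 1) bounds r^T Pi r by
    1 + lambda1 (|e(k)|^2 - gamma^2 (ombar2 + ombar3)). *)

Require Import Defs.
From mathcomp Require Import lra ring.
Set Implicit Arguments.
Unset Strict Implicit.
Unset Printing Implicit Defensive.
Local Open Scope classical_set_scope.
Local Open Scope ring_scope.

(** The bound is asked only at successors because the dynamics leave [r 0] free; a limsup does not
    see the first term. *)
Lemma limn_esup_le_cvg0 (R : realType) (u v : nat -> R) (l : R) :
  (forall n, u n.+1 <= l + v n) -> v n @[n --> \oo] --> 0 ->
  (limn_esup (fun n => (u n)%:E) <= l%:E)%E.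
Proof.
move=> le_uv v0; apply/lee_addgt0Pr => eps eps_gt0.
have [N _ vN] : \forall n \near \oo, v n < eps by exact: cvgr_lt v0 _ eps_gt0.
rewrite /limn_esup /limf_esup.
(* The limsup is an infimum of suprema over neighbourhoods of infinity, so one tail is enough. The
   strict [N < n] excludes index 0 and leaves [N <= n] for the predecessor. *)
apply: (@le_trans _ _ (ereal_sup [set (u n)%:E | n in [set n | (N < n)%N]])).
  apply: ereal_inf_lbound; exists [set n | (N < n)%N] => //.
  by exists N.+1.
apply: ge_ereal_sup => _ [[//|n] /= Nn <-].
rewrite -EFinD lee_fin (le_trans (le_uv n)) // lerD2l ltW //; exact: vN.
Qed.

Section QuadForm.
Variable R : realType.

Lemma mx11_trmx m n (B : 'M[R]_(n, m)) (x : 'cV[R]_m) (y : 'cV[R]_n) :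
  (x^T *m B^T *m y) ord0 ord0 = (y^T *m B *m x) ord0 ord0.
Proof.
have -> : x^T *m B^T *m y = (y^T *m B *m x)^T by rewrite !trmx_mul trmxK mulmxA.
by rewrite [LHS]mxE.
Qed.

Lemma trmxN m n (M : 'M[R]_(m, n)) : (- M)^T = - M^T.
Proof. exact: linearN. Qed.

(** Symmetry is built into the upper-right block, so the two cross terms are transposes of each
    other and merge. Both LMIs are nested blocks, and this expansion is applied at each level. *)
Lemma quad_form_block m n (A : 'M[R]_m) (B : 'M[R]_(n, m)) (D : 'M[R]_n)
    (x : 'cV[R]_m) (y : 'cV[R]_n) :
  quad_form (block_mx A B^T B D) (col_mx x y) =
  quad_form A x + (y^T *m B *m x) ord0 ord0 *+ 2 + quad_form D y.
Proof.
rewrite /quad_form tr_col_mx mul_row_block mul_row_col !mulmxDl.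
rewrite ![(_ + _ : 'M[R]_1) _ _]mxE mx11_trmx; ring.
Qed.

Lemma quad_form_scalar n (a : R) (x : 'cV[R]_n) :
  quad_form a%:M x = a * (x^T *m x) ord0 ord0.
Proof. by rewrite /quad_form mul_mx_scalar -scalemxAl mxE. Qed.

Lemma quad_formN n (M : 'M[R]_n) (x : 'cV[R]_n) :
  quad_form (- M) x = - quad_form M x.
Proof. by rewrite /quad_form mulmxN mulNmx mxE. Qed.

Lemma quad_formB n (M N : 'M[R]_n) (x : 'cV[R]_n) :
  quad_form (M - N) x = quad_form M x - quad_form N x.
Proof. by rewrite /quad_form mulmxBr mulmxBl [LHS]mxE [X in _ + X]mxE. Qed.

Lemma quad_formZ n (a : R) (M : 'M[R]_n) (x : 'cV[R]_n) :
  quad_form (a *: M) x = a * quad_form M x.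
Proof. by rewrite /quad_form -scalemxAr -scalemxAl mxE. Qed.

Lemma quad_formD_arg n (M : 'M[R]_n) (x y : 'cV[R]_n) : M^T = M ->
  quad_form M (x + y) =
  quad_form M x + (y^T *m M *m x) ord0 ord0 *+ 2 + quad_form M y.
Proof.
move=> Msym; have trD : (x + y)^T = x^T + y^T by rewrite linearD.
rewrite /quad_form trD !(mulmxDr, mulmxDl).
rewrite ![(_ + _ : 'M[R]_1) _ _]mxE -[X in x^T *m X *m y]Msym mx11_trmx; ring.
Qed.

Lemma quad_form_mul m n (M : 'M[R]_m) (A : 'M[R]_(m, n)) (x : 'cV[R]_n) :
  quad_form M (A *m x) = quad_form (A^T *m M *m A) x.
Proof. by rewrite /quad_form trmx_mul !mulmxA. Qed.

(** A nonzero row of the left kernel, transposed, would be a nonzero vector with vanishing quadratic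
    form. *)
Lemma posdefmx_unit n (M : 'M[R]_n) : posdefmx M -> M \in unitmx.
Proof.
move=> [Msym Mpos]; rewrite -row_free_unit -kermx_eq0.
apply/eqP/row_matrixP => i; rewrite row0; apply/eqP/negPn/negP => k_neq0.
have /Mpos : (row i (kermx M))^T != 0.
  by apply: contra k_neq0 => /eqP/(congr1 trmx); rewrite trmxK trmx0 => ->.
rewrite /quad_form trmxK.
have -> : row i (kermx M) *m M = 0 by rewrite -row_mul mulmx_ker row0.
by rewrite mul0mx mxE ltxx.
Qed.

(* Test the semidefinite inequality on the vector (x, - mu^-1 x). *)
Lemma schur_norm_le n (P : 'M[R]_n) (mu : R) (x : 'cV[R]_n) : 0 < mu ->
  possemidefmx (block_mx P 1%:M 1%:M mu%:M) ->
  (x^T *m x) ord0 ord0 <= mu * quad_form P x.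
Proof.
move=> mu_gt0 [_ /(_ (col_mx x (- mu^-1 *: x)))].
rewrite -[X in block_mx _ X]trmx1 quad_form_block quad_form_scalar mulmx1.
rewrite linearZ /= -!scalemxAl -!scalemxAr.
set q := quad_form P x; rewrite !mxE; set s := \sum_(i < n) _ => test.
have mu_neq0 : mu != 0 by rewrite gt_eqF.
have : 0 <= mu * (q + (- mu^-1 * s) *+ 2 + mu * (- mu^-1 * (- mu^-1 * s))).
  by rewrite mulr_ge0 // ltW.
have -> : mu * (q + (- mu^-1 * s) *+ 2 + mu * (- mu^-1 * (- mu^-1 * s))) =
          mu * q - s by field.
by rewrite subr_ge0.
Qed.

End QuadForm.

(** The last hypothesis is the error recursion multiplied by [P], with [P L] already replaced by
    [Y], so no inverse appears. At the test vector the off-diagonal blocks contribute twice the form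
    at [x'] and the corner [- P] takes one copy away. *)
Lemma observer_lmi_step (R : realType) (A : 'M[R]_6) (B : 'cV[R]_6)
    (C : 'M[R]_(5, 6)) (alpha mu1 : R) (P : 'M[R]_6) (Y : 'M[R]_(6, 5))
    (x x' : 'cV[R]_6) (w : R) (v : 'cV[R]_5) :
  P^T = P -> negsemidefmx (observer_lmi A B C alpha P Y mu1) ->
  P *m x' = (P - Y *m C) *m A *m x - w *: (P *m B) - Y *m v ->
  quad_form P x' <= (1 - alpha) * quad_form P x
                    + alpha * mu1 * (w * w + (v^T *m v) ord0 ord0).
Proof.
move=> Psym [_ /(_ (col_mx (col_mx x' x) (col_mx (- w)%:M (- v))))] + Px'.
(* This puts the zero block in the transposed shape that [quad_form_block] matches. *)
have zerosym : (0 : 'M[R]_(1, 5)) = (0 : 'M[R]_(5, 1))^T by rewrite trmx0.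
rewrite /observer_lmi /= quad_form_block [X in block_mx _%:M X]zerosym.
rewrite !quad_form_block !quad_form_scalar quad_formN quad_formZ.
rewrite mulmx0 mul0mx tr_col_mx mul_row_block mul_row_col !mulmx0 addr0 mul0mx.
rewrite addr0.
(* Transpose the formula for [P *m x'] and multiply by [x'] on the right. *)
have cross : x^T *m (A^T *m (P - C^T *m Y^T)) *m x' +
    ((- w)%:M^T *m (B^T *m P) + (- v)^T *m Y^T) *m x' = x'^T *m P *m x'.
  have trB m n (M N : 'M[R]_(m, n)) : (M - N)^T = M^T - N^T by rewrite linearB.
  have trZ m n a (M : 'M[R]_(m, n)) : (a *: M)^T = a *: M^T by rewrite linearZ.
  have x'P : x'^T *m P = (P *m x')^T by rewrite trmx_mul Psym.
  rewrite -mulmxDl x'P Px' !(trB, trZ, trmx_mul) Psym !mulmxA.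
  by rewrite trmxN tr_scalar_mx mul_scalar_mx scaleNr !mulNmx -scalemxAl !addrA.
have := congr1 (fun M : 'M[R]_1 => M ord0 ord0) cross.
rewrite -[(x'^T *m P *m x') ord0 ord0]/(quad_form P x') mxE => {}cross.
have -> : ((- w)%:M^T *m (- w)%:M : 'M[R]_1) ord0 ord0 = w * w.
  by rewrite tr_scalar_mx -scalar_mxM mxE eqxx mulr1n mulrNN.
have -> : (- v)^T *m - v = v^T *m v by rewrite trmxN mulNmx mulmxN opprK.
rewrite [(0 : 'M[R]_1) _ _]mxE.
lra.
Qed.

(** With [- v] in the test vector, all terms in [Pi] assemble into minus the form at
    [C *m A *m x + v]. The last coordinate 1 brings in [f3], whose [lambda2 * ombar3] absorbs the
    remaining multiple of the squared norm of [v]. *)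
Lemma monitor_lmi_le (R : realType) (A : 'M[R]_6) (C : 'M[R]_(5, 6))
    (gamma ombar2 ombar3 : R) (Pi : 'M[R]_5) (lambda1 lambda2 : R)
    (x : 'cV[R]_6) (v : 'cV[R]_5) :
  monitor_feasible A C gamma ombar2 ombar3 Pi lambda1 lambda2 ->
  (v^T *m v) ord0 ord0 <= ombar3 ->
  quad_form Pi (C *m A *m x + v) <=
  1 + lambda1 * ((x^T *m x) ord0 ord0 - gamma ^+ 2 * (ombar2 + ombar3)).
Proof.
move=> [[Pisym _] _ lambda2_gt0 [_ /(_ (col_mx (col_mx x (- v)) 1%:M))]] + v_le.
rewrite /monitor_lmi /= -[X in block_mx _ X]trmx0.
rewrite !quad_form_block mulmx0 mul0mx !quad_form_scalar !quad_formB.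
rewrite !quad_form_scalar quad_formD_arg // quad_form_mul trmx_mul !mulmxA.
have -> : quad_form Pi (- v) = quad_form Pi v.
  by rewrite /quad_form trmxN mulmxN !mulNmx opprK.
have -> : (- v)^T *m - v = v^T *m v by rewrite trmxN mulNmx mulmxN opprK.
rewrite trmx1 mul1mx [(0 : 'M[R]_1) _ _]mxE [(1%:M : 'M[R]_1) _ _]mxE /=.
rewrite trmxN !mulNmx [(- _ : 'M[R]_1) _ _]mxE.
set nv := (v^T *m v) _ _ in v_le *; have := ler_wpM2l (ltW lambda2_gt0) v_le.
lra.
Qed.

Theorem proposition1 (R : realType) (h tau Ts kp kd : R)
  (h_gt0 : 0 < h) (tau_gt0 : 0 < tau) (Ts_gt0 : 0 < Ts)
  (alpha : R) (alpha_gt0 : 0 < alpha) (alpha_lt1 : alpha < 1)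
  (mu1 mu2 : R) (P : 'M[R]_6) (Y : 'M[R]_(6, 5))
  (observer_opt : observer_optimal
    (Ae h tau kp kd Ts) (Be1 h tau kp kd Ts) (Ce R) alpha mu1 mu2 P Y)
  (L : 'M[R]_(6, 5)) (L_def : L = invmx P *m Y)
  (gamma : R) (gamma_def : gamma = Num.sqrt (mu1 * mu2))
  (ombar2 ombar3 : R) (ombar2_gt0 : 0 < ombar2) (ombar3_gt0 : 0 < ombar3)
  (Pi : 'M[R]_5) (lambda1 lambda2 : R)
  (monitor_opt : monitor_optimal
    (Ae h tau kp kd Ts) (Ce R) gamma ombar2 ombar3 Pi lambda1 lambda2)
  (e : nat -> 'cV[R]_6) (r : nat -> 'cV[R]_5)
  (omega_u : nat -> R) (omega_e : nat -> 'cV[R]_5)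
  (omega_u_bound : forall k : nat, omega_u k * omega_u k <= ombar2)
  (omega_e_bound : forall k : nat,
    ((omega_e k)^T *m omega_e k) ord0 ord0 <= ombar3)
  (e_dyn : forall k : nat,
    e k.+1 = (1%:M - L *m Ce R) *m Ae h tau kp kd Ts *m e k
             - omega_u k *: Be1 h tau kp kd Ts - L *m omega_e k.+1)
  (r_dyn : forall k : nat,
    r k.+1 = Ce R *m Ae h tau kp kd Ts *m e k + omega_e k.+1) :
  (limn_esup (fun k : nat => (quad_form Pi (r k))%:E) <= 1)%E.
Proof.
have [[mu1_gt0 mu2_gt0 Ppos obs_lmi schur_lmi] _] := observer_opt.
have [mon_feas _] := monitor_opt.
have [_ lambda1_gt0 _ _] := mon_feas.
have PL : P *m L = Y by rewrite L_def mulKVmx // posdefmx_unit.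
have gamma2 : gamma ^+ 2 = mu1 * mu2.
  by rewrite gamma_def sqr_sqrtr // mulr_ge0 ?ltW.
pose V k := quad_form P (e k).
have V_step k : V k.+1 <= (1 - alpha) * V k + alpha * mu1 * (ombar2 + ombar3).
  have step : V k.+1 <= (1 - alpha) * V k + alpha * mu1 *
      (omega_u k * omega_u k + ((omega_e k.+1)^T *m omega_e k.+1) ord0 ord0).
    apply: (observer_lmi_step _ obs_lmi); first by case: Ppos.
    by rewrite e_dyn !mulmxBr -scalemxAr !mulmxA mulmxBr mulmx1 mulmxA PL.
  apply: (le_trans step); rewrite lerD2l ler_wpM2l ?lerD //.
  by rewrite mulr_ge0 // ltW.
(* The constant [mu1 * (ombar2 + ombar3)] is the fixed point of the recursion in [V_step], so the
   excess over it shrinks by [1 - alpha] at each step. *)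
have V_le k : V k <= mu1 * (ombar2 + ombar3) + (1 - alpha) ^+ k * V 0%N.
  elim: k => [|k IH].
    by rewrite expr0 mul1r lerDr mulr_ge0 ?addr_ge0 ?ltW.
  have a_ge0 : 0 <= 1 - alpha by rewrite subr_ge0 ltW.
  have := ler_wpM2l a_ge0 IH; have := V_step k; rewrite exprS; lra.
apply: (limn_esup_le_cvg0
  (v := fun k => (lambda1 * mu2 * V 0%N) * (1 - alpha) ^+ k)).
  move=> k; rewrite r_dyn.
  apply: (le_trans (monitor_lmi_le _ mon_feas (omega_e_bound _))).
  rewrite lerD2l -[lambda1 * mu2 * _]mulrA -mulrA ler_wpM2l ?(ltW lambda1_gt0) //.
  (* Multiplied by [mu2], the fixed point becomes [gamma ^+ 2 * (ombar2 + ombar3)] and cancels; only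
     the geometric term survives. *)
  have := schur_norm_le (e k) mu2_gt0 schur_lmi.
  have := ler_wpM2l (ltW mu2_gt0) (V_le k).
  rewrite gamma2 -/(V k); lra.
rewrite -(mulr0 (lambda1 * mu2 * V 0%N)).
apply: cvgMr; apply: cvg_expr.
by rewrite ger0_norm ?subr_ge0 ?ltW // ltrBlDr ltrDl.
Qed.
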